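(* Let $\Bbbk$ be a field, $S=\Bbbk[x_1,\ldots,x_n]$, and let $I\subseteq S$ be a monomial ideal. If the LCM lattice $\mathcal{L}_I$ is geometric, then $\operatorname{pd}_S(S/I)=\operatorname{rank}(\mathcal{L}_I)$.
   Context: $\operatorname{pd}_S$ denotes projective dimension over $S$. The LCM lattice $\mathcal{L}_I$ of a monomial ideal $I$ is the set of least common multiples of subsets of its minimal monomial generators (the lcm of the empty set is $1$), ordered by divisibility; it is a finite lattice with join lcm. A finite lattice $L$ with bottom $\hat 0$ and top $\hat 1$ is graded if it has an order-preserving function $\operatorname{rk}:L\to\mathbb{Z}$ with $\operatorname{rk}(\hat 0)=0$ and $\operatorname{rk}(y)=\operatorname{rk}(x)+1$ whenever $y$ covers $x$; then $\operatorname{rank}(L)=\operatorname{rk}(\hat 1)$. $L$ is upper semimodular if it is graded and $\operatorname{rk}(x)+\operatorname{rk}(y)\ge\operatorname{rk}(x\wedge y)+\operatorname{rk}(x\vee y)$ for all $x,y\in L$. $L$ is geometric if it is upper semimodular and atomic (every element is a possibly empty finite join of atoms, an atom being an element covering $\hat 0$). *)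

(* Defs.v *)
From HB Require Import structures.
From mathcomp Require Import all_boot all_order all_algebra.
From mathcomp Require Import boolp.
From mathcomp Require Import mpoly.

Set Implicit Arguments.
Unset Strict Implicit.
Unset Printing Implicit Defensive.

Import Order.TTheory GRing.Theory.

Local Open Scope ring_scope.

Section QuotientModule.
Local Open Scope quotient_scope.
Variables (R : pzRingType) (V : lmodType R) (I : submodClosed V).

(* The submodule I again, under a name that also carries closure under
   opposites, which MathComp's submodClosed does not provide. *)
Definition submod_pred : {pred V} := I.

Lemma submod_pred_closed : zmod_closed submod_pred.
Proof. exact: GRing.submod_closedB (submodClosedP I). Qed.

HB.instance Definition _ := GRing.isZmodClosed.Build V submod_pred
  submod_pred_closed.

Definition quotmod := Quotient.quot submod_pred.

HB.instance Definition _ := GRing.Zmodule.on quotmod.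
HB.instance Definition _ := Quotient.on quotmod.

Definition quot_scale (a : R) (x : quotmod) : quotmod :=
  \pi_quotmod (a *: repr x).

Lemma pi_quotmodD (u v : V) :
  \pi_quotmod (u + v) = \pi_quotmod u + \pi_quotmod v :> quotmod.
Proof. by rewrite /quotmod !piE. Qed.

Lemma eq_pi_quotmod (u v : V) :
  (\pi_quotmod u == \pi_quotmod v :> quotmod) = (u - v \in I).
Proof. by rewrite /quotmod piE. Qed.

Lemma quot_scaleE a (v : V) :
  quot_scale a (\pi_quotmod v) = \pi_quotmod (a *: v).
Proof.
apply/eqP; rewrite /quot_scale eq_pi_quotmod -scalerBr rpredZ //.
by rewrite -eq_pi_quotmod reprK.
Qed.

Lemma quot_scalerA a b x :
  quot_scale a (quot_scale b x) = quot_scale (a * b) x.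
Proof. by elim/quotW: x => v; rewrite (quot_scaleE b) 2!quot_scaleE scalerA. Qed.
Lemma quot_scale1r : left_id 1 quot_scale.
Proof. by elim/quotW=> v; rewrite quot_scaleE scale1r. Qed.

Lemma quot_scalerDr : right_distributive quot_scale +%R.
Proof.
move=> a; elim/quotW=> u; elim/quotW=> v.
by rewrite -pi_quotmodD !quot_scaleE scalerDr pi_quotmodD.
Qed.

Lemma quot_scalerDl x : {morph quot_scale^~ x : a b / a + b}.
Proof.
by elim/quotW: x => v a b; rewrite !quot_scaleE scalerDl pi_quotmodD.
Qed.

HB.instance Definition _ := GRing.Zmodule_isLmodule.Build R quotmod
  quot_scalerA quot_scale1r quot_scalerDr quot_scalerDl.

End QuotientModule.

Section ProjectiveDimension.
Variable R : nzRingType.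

Definition surj (A B : Type) (f : A -> B) := forall y, exists x, f x = y.

Definition exact (A B C : lmodType R) (f : A -> B) (g : B -> C) :=
  forall y, g y = 0 <-> exists x, f x = y.

Definition projective (P : lmodType R) :=
  forall (M N : lmodType R) (f : {linear M -> N}) (g : {linear P -> N}),
    surj f -> exists h : {linear P -> M}, forall x, f (h x) = g x.

Definition has_projres (M : lmodType R) (d : nat) :=
  exists (P : nat -> lmodType R) (e : {linear P 0 -> M})
         (delta : forall i, {linear P i.+1 -> P i}),
    [/\ forall i, projective (P i),
        surj e,
        exact (delta 0) e,
        forall i, exact (delta i.+1) (delta i)
      & forall i, (d < i)%N -> forall x : P i, x = 0].

(* The zero module gets dimension 0 (not -oo). *)
Definition has_projdim (M : lmodType R) (d : nat) :=
  has_projres M d /\ forall e, has_projres M e -> (d <= e)%N.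

End ProjectiveDimension.

Section Geometric.
Local Open Scope order_scope.
Variables (d : Order.disp_t) (L : finTBLatticeType d).

Definition covers (x y : L) : bool :=
  (x < y) && [forall z, ~~ (x < z < y)].

Definition rank_function (rk : L -> int) :=
  [/\ {homo rk : x y / x <= y >-> (x <= y)%R},
      rk \bot = 0
    & forall x y, covers x y -> rk y = (rk x + 1)%R].

Definition upper_semimodular :=
  exists2 rk : L -> int, rank_function rk
    & forall x y, (rk (x `&` y) + rk (x `|` y) <= rk x + rk y)%R.

Definition atom (a : L) := covers \bot a.

Definition atomic :=
  forall x : L, exists2 A : {set L}, {in A, forall a, atom a}
    & x = \join_(a in A) a.

Definition geometric := upper_semimodular /\ atomic.

(* Junk value 0 when L is not graded; see rankE otherwise. *)
Definition rank : int :=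
  if pselect (exists rk, rank_function rk) is left h then sval (cid h) \top
  else 0.

Lemma rank_function_unique rk1 rk2 :
  rank_function rk1 -> rank_function rk2 -> rk1 =1 rk2.
Proof.
move=> [_ b1 c1] [_ b2 c2] x.
have [m] := ubnP #|[pred z : L | z < x]|; elim: m x => // m IH x.
rewrite ltnS => lexm; have [->|x0] := eqVneq x \bot; first by rewrite b1 b2.
have lt0x : \bot < x by rewrite lt0x.
case: (@arg_maxnP L \bot (fun y => y < x) (fun y => #|[pred z | z < y]|) lt0x).
move=> y ltyx ymax; have cyx : covers y x.
  rewrite /covers ltyx; apply/forallP => z; apply/negP => /andP[yz zx].
  have := ymax z zx; rewrite /= /geq /= leqNgt => /negP; apply; apply: proper_card.
  apply/properP; split.
    by apply/subsetP => w; rewrite !inE => /lt_trans; apply.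
  by exists y; rewrite !inE ?ltxx.
rewrite (c1 _ _ cyx) (c2 _ _ cyx) IH //; apply: leq_trans lexm.
apply: proper_card; apply/properP; split.
  by apply/subsetP => w; rewrite !inE => /lt_trans; apply.
by exists y; rewrite !inE ?ltxx.
Qed.

Lemma rankE rk : rank_function rk -> rank = rk \top.
Proof.
move=> hrk; rewrite /rank; case: pselect => [h|[]]; last by exists rk.
by case: cid => rk' /= hrk'; apply: rank_function_unique.
Qed.

End Geometric.

Section Dickson.
Variable n : nat.
Implicit Types (P : 'X_{1..n} -> Prop) (m g : 'X_{1..n}).

Lemma dickson P : exists s : seq 'X_{1..n},
  (forall g, g \in s -> P g) /\
  forall m, P m -> exists2 g, g \in s & (g <= m)%MM.
Proof.
suff H j : (j <= n)%N -> forall P, exists s : seq 'X_{1..n},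
    (forall g, g \in s -> P g) /\
    forall m, P m ->
      exists2 g, g \in s & forall i : 'I_n, (i < j)%N -> (g i <= m i)%N.
  have [s [sP Ps]] := H n (leqnn n) P; exists s; split=> // m /Ps[g gs le_gm].
  by exists g => //; apply/mnm_lepP => i; apply: le_gm.
elim: j => [_|j IH ltjn] {}P.
  have [[m Pm]|nP] := pselect (exists m, P m).
    exists [:: m]; split=> [g|m' _]; first by rewrite inE => /eqP->.
    by exists m; rewrite ?inE.
  by exists [::]; split=> // m Pm; case: nP; exists m.
pose o := Ordinal ltjn.
have {}IH := IH (ltnW ltjn).
have [s0 [s0P Ps0]] := IH P.
pose N := (\max_(g <- s0) g o)%N.
pose F c := cid (IH (fun m => P m /\ m o = c)).
exists (s0 ++ flatten [seq sval (F c) | c <- iota 0 N]); split=> [g|m Pm].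
  rewrite mem_cat => /orP[/s0P//|/flattenP[_ /mapP[c _ ->]]].
  by case: (F c) => s /= [sP _] /sP[].
have [ltmN|leNm] := ltnP (m o) N.
  case E: (F (m o)) => [s [sP Ps]]; have [g gs le_gm] := Ps m (conj Pm erefl).
  exists g.
    rewrite mem_cat; apply/orP; right; apply/flattenP.
    exists s => //; apply/mapP; exists (m o); first by rewrite mem_iota.
    by rewrite E.
  move=> i; rewrite ltnS leq_eqVlt => /orP[/eqP eij|/le_gm//].
  by rewrite (_ : i = o) ?(sP g gs).2 //; apply: val_inj.
have [g gs le_gm] := Ps0 m Pm; exists g; first by rewrite mem_cat gs.
move=> i; rewrite ltnS leq_eqVlt => /orP[/eqP eij|/le_gm//].
rewrite (_ : i = o); last exact: val_inj.
by apply: leq_trans leNm; rewrite /N (big_rem g) //= leq_maxl.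
Qed.

End Dickson.

Section MonomialIdeal.
Variables (k : fieldType) (n : nat).
Local Notation S := {mpoly k[n]}.

(* An ideal of S is a submodule of the regular module S^o. *)
Definition monomial_gens (I : submodClosed S^o) (G : 'X_{1..n} -> Prop) :=
  forall f : S, f \in I <->
    exists2 s : seq (S * 'X_{1..n}), (forall t, t \in s -> G t.2)
      & f = \sum_(t <- s) t.1 * 'X_[t.2].

Definition monomial_ideal (I : submodClosed S^o) := exists G, monomial_gens I G.

Definition min_gen (I : submodClosed S^o) (m : 'X_{1..n}) :=
  ('X_[m] : S) \in I /\
  forall m' : 'X_{1..n}, ('X_[m'] : S) \in I -> (m' <= m)%MM -> m' = m.

Lemma monomial_gens_mem (I : submodClosed S^o) G (m : 'X_{1..n}) :
  monomial_gens I G -> ('X_[m] : S) \in I -> exists2 g, G g & (g <= m)%MM.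
Proof.
move=> GI /GI[s sG /(congr1 (mcoeff m))]; rewrite mcoeffX eqxx raddf_sum /=.
apply: contraPP => noG; rewrite big_seq big1 => [|t ts].
  by move/eqP; rewrite oner_eq0.
rewrite mcoeffMr big1 // => -[k1 k2] /= /eqP em.
rewrite mcoeffX; case: eqVneq => [ek|]; last by rewrite mulr0.
case: noG; exists t.2; first exact: sG.
by rewrite em ek lem_addr.
Qed.

Lemma min_gen_below (I : submodClosed S^o) (m : 'X_{1..n}) :
  ('X_[m] : S) \in I -> exists2 g, min_gen I g & (g <= m)%MM.
Proof.
have [c] := ubnP (mdeg m); elim: c m => // c IH m; rewrite ltnS => lemc Im.
have [[m' [Im' lem ne]]|no] := pselect (exists m', [/\ ('X_[m'] : S) \in I,
    (m' <= m)%MM & m' <> m]); last first.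
  exists m; last exact: lepm_refl.
  by split=> // m' Im' lem; apply: contra_notP no; exists m'.
have [|g mg leg] := IH m' _ Im'; last by exists g => //; apply: lepm_trans lem.
apply: leq_trans lemc; rewrite -(submK lem) mdegD -[X in (X < _)%N]add0n ltn_add2r.
rewrite lt0n mdeg_eq0; apply/eqP => e0; apply: ne.
by rewrite -(submK lem) e0 add0m.
Qed.

Lemma monomial_gens_le (I : submodClosed S^o) (G H : 'X_{1..n} -> Prop) :
  monomial_gens I G -> (forall m, H m -> ('X_[m] : S) \in I) ->
  (forall m, G m -> exists2 g, H g & (g <= m)%MM) -> monomial_gens I H.
Proof.
move=> GI HI GH f; split=> [/GI[s sG ->]|[s sH ->]]; last first.
  rewrite big_seq; apply: rpred_sum => t /sH/HI.
  exact: (rpredZ t.1).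
elim: s sG => [|t s IH] sG; first by exists [::]; rewrite ?big_nil.
have [|s' s'H e'] := IH; first by move=> u us; apply: sG; rewrite inE us orbT.
have [|g Hg leg] := GH t.2; first by apply: sG; rewrite mem_head.
exists ((t.1 * 'X_[t.2 - g], g) :: s') => [u|].
  by rewrite inE => /orP[/eqP->|/s'H].
by rewrite !big_cons /= -e' -mulrA -mpolyXD submK.
Qed.

(* By this and min_gen_least, min_gen I is the least, hence the unique minimal,
   set of monomials generating I. *)
Lemma min_gen_gens (I : submodClosed S^o) :
  monomial_ideal I -> monomial_gens I (min_gen I).
Proof.
move=> [G GI]; apply: (monomial_gens_le GI) => [m []//|m Gm].
apply: min_gen_below; apply/GI; exists [:: (1, m)].
  by move=> t; rewrite inE => /eqP->.
by rewrite big_seq1 mul1r.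
Qed.

Lemma min_gen_least (I : submodClosed S^o) G m :
  monomial_gens I G -> min_gen I m -> G m.
Proof.
move=> GI [Im mmin]; have [g Gg leg] := monomial_gens_mem GI Im.
suff <- : g = m by [].
apply: mmin => //; apply/GI; exists [:: (1, g)].
  by move=> t; rewrite inE => /eqP->.
by rewrite big_seq1 mul1r.
Qed.

End MonomialIdeal.

Fact lcm_display : Order.disp_t. Proof. exact: Order.Disp tt tt. Qed.

Section LcmLattice.
Variables (k : fieldType) (n : nat) (I : submodClosed {mpoly k[n]}^o).
Local Open Scope order_scope.

(* Repetitions in s are harmless, so s stands for the finite set {g | g \in s}. *)
Definition is_lcm (m : 'X_{1..n}) :=
  exists2 s : seq 'X_{1..n}, (forall g, g \in s -> min_gen I g)
    & m = \big[@mlcm n/0%MM]_(g <- s) g.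

Record lcm_lattice :=
  LcmLattice { lcm_val : 'X_{1..n}; lcm_valP : `[< is_lcm lcm_val >] }.

HB.instance Definition _ := [isSub for lcm_val].
HB.instance Definition _ := [Countable of lcm_lattice by <:].

Implicit Types x y z : lcm_lattice.

Definition lcm_le x y := (lcm_val x <= lcm_val y)%MM.

Lemma lcm_le_refl : reflexive lcm_le.
Proof. by move=> x; apply: lepm_refl. Qed.

Lemma lcm_le_anti : antisymmetric lcm_le.
Proof.
move=> x y /andP[/mnm_lepP xy /mnm_lepP yx]; apply: val_inj.
by apply/mnmP => i; apply/eqP; rewrite eqn_leq xy yx.
Qed.

Lemma lcm_le_trans : transitive lcm_le.
Proof. by move=> y x z; apply: lepm_trans. Qed.

HB.instance Definition _ := Order.Le_isPOrder.Build lcm_display lcm_lattice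
  lcm_le_refl lcm_le_anti lcm_le_trans.

Lemma leEval x y : (x <= y) = (lcm_val x <= lcm_val y)%MM.
Proof. by []. Qed.

Lemma big_mlcm_le (s : seq 'X_{1..n}) (m : 'X_{1..n}) :
  (\big[@mlcm n/0%MM]_(g <- s) g <= m)%MM = all (fun g => (g <= m)%MM) s.
Proof.
elim: s => [|g s IH] /=; first by rewrite big_nil; apply/mnm_lepP => i; rewrite mnm0E.
by rewrite big_cons lem_mlcm IH.
Qed.

Lemma mlcmA : associative (@mlcm n).
Proof. by move=> a b c; apply/mnmP => i; rewrite !mnmE maxnA. Qed.

Lemma is_lcm0 : is_lcm 0%MM.
Proof. by exists [::]; rewrite ?big_nil. Qed.

Lemma is_lcmU m1 m2 : is_lcm m1 -> is_lcm m2 -> is_lcm (mlcm m1 m2).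
Proof.
move=> [s1 P1 ->] [s2 P2 ->]; exists (s1 ++ s2) => [g|].
  by rewrite mem_cat => /orP[/P1|/P2].
elim: s1 {P1} => [|g s IH]; first by rewrite big_nil mlc0m.
by rewrite cat_cons !big_cons -mlcmA IH.
Qed.

Definition lcm_bot : lcm_lattice := LcmLattice (introT (asboolP _) is_lcm0).

Definition lcm_join x y : lcm_lattice := LcmLattice
  (introT (asboolP _) (is_lcmU (asboolW (lcm_valP x)) (asboolW (lcm_valP y)))).

Lemma lcm_joinP x y z : (lcm_join x y <= z) = (x <= z) && (y <= z).
Proof. exact: lem_mlcm. Qed.

Lemma lcm_bot_le x : lcm_bot <= x.
Proof. by apply/mnm_lepP => i; rewrite mnm0E. Qed.

(* Dickson's lemma makes the lattice finite. *)
Lemma lcm_bound : exists M : 'X_{1..n}, forall x, (lcm_val x <= M)%MM.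
Proof.
have [s [sG Gs]] := dickson (min_gen I).
exists (\big[@mlcm n/0%MM]_(g <- s) g) => -[m hm] /=.
have [t tG ->] := asboolW hm; rewrite big_mlcm_le; apply/allP => g /tG mg.
have [h hs leh] := Gs g mg; rewrite -(mg.2 h (sG h hs).1 leh).
have := lepm_refl (\big[@mlcm n/0%MM]_(g <- s) g).
by rewrite big_mlcm_le => /allP; apply.
Qed.

Definition lcm_enum : seq lcm_lattice :=
  undup (pmap insub
    [seq (bmnm m) | m <- enum {: 'X_{1..n < (mdeg (sval (cid lcm_bound))).+1}}]).

Lemma lcm_enumP : Finite.axiom lcm_enum.
Proof.
apply: Finite.uniq_enumP; first exact: undup_uniq.
move=> x; rewrite mem_undup mem_pmap_sub; apply/mapP.
have lt : (mdeg (lcm_val x) < (mdeg (sval (cid lcm_bound))).+1)%N.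
  rewrite ltnS; case: cid => M /= /(_ x) le.
  by rewrite -(submK le) mdegD leq_addl.
by exists (BMultinom lt); rewrite ?mem_enum.
Qed.

HB.instance Definition _ := isFinite.Build lcm_lattice lcm_enumP.

Definition lcm_meet x y : lcm_lattice :=
  \big[lcm_join/lcm_bot]_(z | (z <= x) && (z <= y)) z.

Lemma big_lcm_joinP (P : pred lcm_lattice) x :
  (\big[lcm_join/lcm_bot]_(z | P z) z <= x) = [forall (z | P z), z <= x].
Proof.
rewrite -big_filter; apply/idP/forall_inP => [H z Pz|].
  have : z \in [seq i <- index_enum lcm_lattice | P i].
    by rewrite mem_filter Pz mem_index_enum.
  elim: {Pz P} (filter _ _) H => [//|w s IH].
  rewrite big_cons lcm_joinP => /andP[wx sx].
  by rewrite inE => /orP[/eqP->|/(IH sx)].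
move=> H; rewrite big_filter; elim/big_ind: _ => //; first exact: lcm_bot_le.
by move=> u v ux vx; rewrite lcm_joinP ux vx.
Qed.

Lemma lcm_meetP x y z : (x <= lcm_meet y z) = (x <= y) && (x <= z).
Proof.
apply/idP/idP => [le|xyz].
  have : (lcm_meet y z <= y) && (lcm_meet y z <= z).
    by rewrite !big_lcm_joinP; apply/andP; split;
       apply/forall_inP => w /andP[].
  by case/andP => ly lz; rewrite !(le_trans le).
have := lexx (lcm_meet y z); rewrite {1}/lcm_meet big_lcm_joinP.
by move/forall_inP; apply.
Qed.

HB.instance Definition _ := Order.POrder_MeetJoin_isLattice.Build
  lcm_display lcm_lattice lcm_meetP lcm_joinP.

Definition lcm_top : lcm_lattice := \big[lcm_join/lcm_bot]_z z.

Lemma lcm_top_ge x : x <= lcm_top.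
Proof.
have := lexx lcm_top; rewrite {1}/lcm_top big_lcm_joinP.
by move/forall_inP; apply.
Qed.

HB.instance Definition _ :=
  Order.hasBottom.Build lcm_display lcm_lattice lcm_bot_le.
HB.instance Definition _ :=
  Order.hasTop.Build lcm_display lcm_lattice lcm_top_ge.

End LcmLattice.

(* Main.v *)
(* Let L be the LCM lattice and r its rank.

   Upper bound.  A monotone family A of subspaces of k^N indexed by L determines
   the graded submodule of S^N whose degree m part is A (t m) x^m, where t m is
   the largest element of L dividing m; the ideal I has this form with N = 1.
   Choosing a basis of each A c covers this module by a free module on
   generators of degrees in L.  The kernel is again of this form, and since the
   chosen generators of lowest rank are independent, the least rank at which
   the family is nonzero has gone up.  Hence the syzygies stop after r steps.

   Lower bound.  A geometric lattice has a basis b_1, ..., b_r of atoms; the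
   hyperplanes H_i spanned by the b_l with l <> i have meet 0.  Pick a variable
   x_{j_i} whose exponent in H_i is smaller than in the top element.  Dividing
   the top element by x_{j_1} ... x_{j_r} gives a monomial outside I that all
   the x_{j_i} multiply into I.  Thus S/I has a nonzero element killed by a
   regular sequence of length r, which forces every projective resolution to
   have length at least r. *)

Require Import Defs.
From HB Require Import structures.
From mathcomp Require Import all_boot all_order all_algebra.
From mathcomp Require Import boolp.
From mathcomp Require Import mpoly freeg zify.
Set Implicit Arguments.
Unset Strict Implicit.
Unset Printing Implicit Defensive.
Import Order.TTheory GRing.Theory Num.Theory.
Local Open Scope ring_scope.

(** * Projective modules and splicing of resolutions *)

Section Projective.
Variable R : nzRingType.

Lemma linear_inverse (P Q : lmodType R) (f : {linear P -> Q}) :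
  injective f -> surj f -> exists g : {linear Q -> P}, cancel g f /\ cancel f g.
Proof.
move=> finj fsurj; pose g y := sval (cid (fsurj y)).
have gK y : f (g y) = y by rewrite /g; case: cid.
have glin : linear g by move=> a u v; apply: finj; rewrite linearP !gK.
pose gL : {linear Q -> P} := HB.pack g (GRing.isLinear.Build R Q P *:%R g glin).
by exists gL; split=> [//|x]; apply: finj; rewrite gK.
Qed.

Lemma projective_bij (P Q : lmodType R) (f : {linear P -> Q}) :
  projective P -> injective f -> surj f -> projective Q.
Proof.
move=> projP finj fsurj M N p g psurj.
have [h hE] := projP M N p (g \o f) psurj.
have [f' [f'K _]] := linear_inverse finj fsurj.
by exists (h \o f') => y /=; rewrite hE /= f'K.
Qed.

Lemma projective_trivial (M : lmodType R) : (forall x : M, x = 0) -> projective M.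
Proof.
move=> M0 A B f g _; exists (\0 : {linear M -> A}) => x.
by rewrite (M0 x) !linear0.
Qed.

Lemma projective_rV N : projective 'rV[R]_N.
Proof.
move=> A B f g fsurj; pose a i := sval (cid (fsurj (g (delta_mx 0 i)))).
have aE i : f (a i) = g (delta_mx 0 i) by rewrite /a; case: cid.
pose h (v : 'rV[R]_N) := \sum_i v 0 i *: a i.
have hlin : linear h.
  move=> c u v; rewrite /h scaler_sumr -big_split; apply: eq_bigr => i _ /=.
  by rewrite !mxE scalerDl scalerA.
pose hL : {linear 'rV[R]_N -> A} :=
  HB.pack h (GRing.isLinear.Build R 'rV[R]_N A *:%R h hlin).
exists hL => v /=.
rewrite /h [in RHS](row_sum_delta v) !linear_sum; apply: eq_bigr => i _.
by rewrite !linearZ /= aE.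
Qed.

Lemma projective_regular : projective R^o.
Proof.
pose f (v : 'rV[R]_1) : R^o := v 0 0.
have flin : linear f by move=> c u v; rewrite /f !mxE.
pose fL : {linear 'rV[R]_1 -> R^o} :=
  HB.pack f (GRing.isLinear.Build R 'rV[R]_1 R^o *:%R f flin).
apply: (@projective_bij _ _ fL); first exact: projective_rV.
  by move=> u v /= uv; apply/rowP => i; rewrite !ord1.
by move=> y; exists (const_mx y); rewrite /= /f mxE.
Qed.

Lemma has_projres_projective (M : lmodType R) : projective M -> has_projres M 0.
Proof.
move=> projM.
pose P i : lmodType R := if i is 0 then M else 'rV[R]_0.
exists P, (idfun : {linear M -> M}), (fun i => \0 : {linear P i.+1 -> P i}).
have P0 i (x : P i.+1) : x = 0 by exact: thinmx0.
split=> [[|i]|y|y|i y|[|i] // _].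
- exact: projM.
- exact: projective_rV.
- by exists y.
- by split=> [/= ->|[x <-]]; [exists 0|].
- by split=> // _; exists 0; rewrite (P0 _ y).
Qed.

(** The resolution of [K] is shifted by one degree and joined to [P] through [i \o q], which has the
    same kernel as [q] because [i] is injective. *)
Lemma has_projres_step (K P M : lmodType R) (i : {linear K -> P})
    (e : {linear P -> M}) d :
  projective P -> injective i -> exact i e -> surj e ->
  has_projres K d -> has_projres M d.+1.
Proof.
move=> projP iinj exie esurj [Q [q [delta [projQ qsurj ex0 ex Q0]]]].
pose F j : lmodType R := if j is j'.+1 then Q j' else P.
pose del j : {linear F j.+1 -> F j} :=
  match j with 0 => i \o q | j'.+1 => delta j' end.
exists F, e, del.
split=> [[|j]//|//|y|[|j] y|[|j]//= dj]; rewrite ?exie //=.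
- split=> [[x <-]|[x <-]]; last by exists (q x).
  by have [z <-] := qsurj x; exists z.
- rewrite -ex0; split=> [/= h|/= ->]; last exact: linear0.
  by apply: iinj; rewrite h linear0.
- exact: ex.
- exact: Q0.
Qed.

End Projective.

Section QuotientProjection.
Local Open Scope quotient_scope.
Variables (R : pzRingType) (V : lmodType R) (I : submodClosed V).

Lemma pi_quotmod_eq0 (u : V) : (\pi_(quotmod I) u == 0) = (u \in I).
Proof.
have <- : \pi_(quotmod I) 0 = 0.
  by apply: (addrI (\pi_(quotmod I) 0)); rewrite -pi_quotmodD !addr0.
by rewrite eq_pi_quotmod subr0.
Qed.

End QuotientProjection.

(** * Regular sequences and the length of resolutions *)

Section LowerBound.
Variables (R : comNzRingType) (y : nat -> R).

Definition in_span (M : lmodType R) k (x : M) :=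
  exists u : nat -> M, x = \sum_(j < k) y j *: u j.

(* Weakly regular: the quotient of M is not required to be nonzero. *)
Definition regular_on (M : lmodType R) r :=
  forall k (x : M), (k < r)%N -> in_span k (y k *: x) -> in_span k x.

Section InSpan.
Variables (M : lmodType R) (k : nat).
Implicit Types x : M.

Lemma in_span0 : in_span k (0 : M).
Proof. by exists (fun=> 0); rewrite big1 // => i _; rewrite scaler0. Qed.

Lemma in_spanD x1 x2 : in_span k x1 -> in_span k x2 -> in_span k (x1 + x2).
Proof.
move=> [u1 ->] [u2 ->]; exists (fun i => u1 i + u2 i).
by rewrite -big_split; apply: eq_bigr => i _; rewrite scalerDr.
Qed.

Lemma in_spanZ a x : in_span k x -> in_span k (a *: x).
Proof.
move=> [u ->]; exists (fun i => a *: u i).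
by rewrite scaler_sumr; apply: eq_bigr => i _; rewrite !scalerA mulrC.
Qed.

Lemma in_spanN x : in_span k x -> in_span k (- x).
Proof. by rewrite -scaleN1r; apply: in_spanZ. Qed.

Lemma in_span_linear (N : lmodType R) (f : {linear M -> N}) x :
  in_span k x -> in_span k (f x).
Proof.
move=> [u ->]; exists (f \o u).
by rewrite linear_sum; apply: eq_bigr => i _; rewrite linearZ.
Qed.

Lemma in_span_mem l x : (l < k)%N -> in_span k (y l *: x).
Proof.
move=> ltlk; exists (fun i => if i == l then x else 0).
rewrite (bigD1 (Ordinal ltlk)) //= eqxx big1 ?addr0 // => i.
by rewrite -val_eqE /= => /negPf ->; rewrite scaler0.
Qed.

Lemma in_spanS x : in_span k.+1 x <-> exists v, in_span k (x - y k *: v).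
Proof.
split=> [[u ->]|[v [u /eqP]]].
  by exists (u k), u; rewrite big_ord_recr /= addrK.
rewrite subr_eq => /eqP ->; exists (fun i => if i == k then v else u i).
rewrite big_ord_recr /= eqxx; congr (_ + _); apply: eq_bigr => i _.
by rewrite ltn_eqF.
Qed.

End InSpan.

(** By projectivity [P] is a retract of the free module on all its elements. There regularity is
    checked on each coefficient in [R], and the result is carried back to [P]. *)
Lemma regular_on_projective (P : lmodType R) r :
  projective P -> regular_on R^o r -> regular_on P r.
Proof.
move=> projP regR k x ltkr [u xE].
pose f : {freeg P / R} -> P := fglift id.
have fD : {morph f : a b / a - b} by exact: lift_is_additive.
have f0 : f 0 = 0 by rewrite -(subrr 0) fD subrr.
have fadd : {morph f : a b / a + b}.
  by move=> a b; rewrite -[b in LHS]opprK fD -(sub0r b) fD f0 sub0r opprK.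
have fE D : f D = \sum_(c <- dom D) coeff c D *: c.
  rewrite -[in LHS](freeg_sumE D) (big_morph f fadd f0).
  by apply: eq_bigr => c _; rewrite /f liftU.
have flin : linear f.
  move=> a D1 D2; rewrite fadd; congr (_ + _).
  rewrite -[in LHS](freeg_sumE D1) scaler_sumr (big_morph f fadd f0).
  rewrite fE scaler_sumr; apply: eq_bigr => c _.
  rewrite (_ : a *: _ = << a * coeff c D1 *g c >>) ?[f _]liftU ?scalerA //.
  by apply/eqP/freeg_eqP => z; rewrite coeffZ !coeffU mulrA.
pose fL : {linear {freeg P / R} -> P} :=
  HB.pack f (GRing.isLinear.Build R {freeg P / R} P *:%R f flin).
have [p|h hK] := projP _ _ fL idfun.
  by exists << p >>; rewrite /= /f liftU scale1r.
have coeffs c : exists t : nat -> R, coeff c (h x) = \sum_(j < k) y j * t j.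
  apply: (regR k _ ltkr); exists (fun j => coeff c (h (u j))).
  rewrite -[_ *: _]/(y k * _) -coeffZ -linearZ xE linear_sum raddf_sum /=.
  by apply: eq_bigr => j _; rewrite linearZ coeffZ.
pose t c := sval (cid (coeffs c)).
have tE c : coeff c (h x) = \sum_(j < k) y j * t c j by rewrite /t; case: cid.
exists (fun j => \sum_(c <- dom (h x)) t c j *: c).
rewrite -[LHS]hK /= fE (eq_bigr _ (fun c _ => congr1 (fun a => a *: c) (tE c))).
under eq_bigr do rewrite scaler_suml.
rewrite exchange_big; apply: eq_bigr => j _; rewrite scaler_sumr.
by apply: eq_bigr => c _; rewrite scalerA.
Qed.

(* The sequence y kills a nonzero element m of M but is regular on the
   resolution, which therefore stays exact modulo (y 0, ..., y k.-1) in degrees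
   above k.  Connecting homomorphisms then carry m to a nonzero class of
   H_k(F / (y 0, ..., y k.-1) F) for each k <= r. *)
Lemma projres_length (M : lmodType R) (m : M) r d :
  regular_on R^o r -> m <> 0 -> (forall l, (l < r)%N -> y l *: m = 0) ->
  has_projres M d -> (r <= d)%N.
Proof.
move=> regR m0 ym [F [e [del [projF esurj ex0 ex Fd]]]].
have reg i := regular_on_projective (projF i) regR.
have delZ i a x : del i (a *: x) = a *: del i x by exact: linearZZ.
have delB i u v : del i (u - v) = del i u - del i v by exact: linearB.
have deldel i x : del i (del i.+1 x) = 0 by apply/ex; exists x.
(* Induction on [k]: if the boundary of [x] is [y k *: v] modulo the first [k] terms, regularity
   cancels [y k] and makes [v] a cycle, hence the boundary of some [w]; then [x - y k *: w] is a
   cycle too. *)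
have exY k : (k <= r)%N -> forall i (x : F i.+1), (k <= i)%N ->
    in_span k (del i x) -> exists z, in_span k (x - del i.+1 z).
  elim: k => [|k IH] ltkr i x leki.
    case=> u; rewrite big_ord0 => /ex[z <-].
    by exists z; rewrite subrr; apply: in_span0.
  case: i leki x => // i leki x /in_spanS[v xv].
  have /(reg _ _ _ ltkr) delv : in_span k (y k *: del i v).
    have := in_spanN (in_span_linear (del i) xv).
    by rewrite delB delZ deldel sub0r opprK.
  have [w vw] := IH (ltnW ltkr) i v leki delv.
  have [|z xz] := IH (ltnW ltkr) i.+1 (x - y k *: w) (leqW leki).
    have := in_spanD xv (in_spanZ (y k) vw).
    by rewrite scalerBr addrA subrK delB delZ.
  exists z; apply/in_spanS; exists w.
  by rewrite addrAC.
(* The next [q] is a [z] with boundary [y k *: q] modulo the first [k] terms. The second condition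
   provides it, and regularity keeps its class nonzero. *)
have stage k : (k <= r)%N -> exists2 q : F k,
    ~ (exists z, in_span k (q - del k z)) &
    forall l, (l < r)%N -> exists z, in_span k (y l *: q - del k z).
  elim: k => [_|k IH ltkr].
    have [q qm] := esurj m; exists q => [[z [u]]|l ltlr].
      rewrite big_ord0 => /eqP; rewrite subr_eq0 => /eqP qz.
      by apply: m0; rewrite -qm; apply/ex0; exists z.
    have /ex0[z zE] : e (y l *: q) = 0 by rewrite linearZZ qm ym.
    by exists z; rewrite zE subrr; apply: in_span0.
  have [q qn qy] := IH (ltnW ltkr); have [z qz] := qy k ltkr.
  exists z => [[s /in_spanS[t zst]]|l ltlr].
    apply: qn; exists t; apply: (reg _ _ _ ltkr).
    have := in_spanD qz (in_span_linear (del k) zst).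
    by rewrite !delB delZ deldel subr0 addrA subrK -scalerBr.
  have [s qs] := qy l ltlr.
  have [||w zw] := exY k (ltnW ltkr) k (y l *: z - y k *: s) => //.
    have := in_spanD (in_spanZ (y k) qs) (in_spanN (in_spanZ (y l) qz)).
    rewrite !scalerBr !scalerA (mulrC (y l)) delB !delZ.
    by rewrite opprB addrC addrA subrK.
  by exists w; apply/in_spanS; exists s; rewrite addrAC.
have [q qn _] := stage r (leqnn r); rewrite leqNgt; apply/negP => ltdr.
apply: qn; exists 0; rewrite linear0 subr0 (Fd r ltdr q).
exact: in_span0.
Qed.

End LowerBound.

(** * Distinct variables form a regular sequence *)

Section RegularVariables.
Variables (k : fieldType) (n : nat).
Local Notation S := {mpoly k[n]}.

Lemma mcoeff_Xmul_eq0 (i : 'I_n) (p : S) (m : 'X_{1..n}) :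
  m i = 0%N -> ('X_i * p)@_m = 0.
Proof.
move=> mi0; rewrite mcoeffM big1 // => -[m1 m2] /= /eqP mE.
rewrite mcoeffX; case: eqVneq => [e1|_]; last by rewrite mul0r.
by have := congr1 (fun m' : 'X_{1..n} => m' i) mE; rewrite mi0 -e1 mnmDE mnm1E eqxx.
Qed.

Lemma in_span_X (s : seq 'I_n) j (p : S^o) : (j <= size s)%N ->
  in_span (fun l => nth 0 [seq 'X_i | i <- s] l : S) j p <->
  forall m, p@_m != 0 -> has (fun i => m i != 0%N) (take j s).
Proof.
move=> lejs; split=> [[u ->] m|suppp].
  apply: contraR => /hasPn m0; rewrite raddf_sum big1 // => l _ /=.
  have ltl := leq_trans (ltn_ord l) lejs.
  have i0 : 'I_n by case: s {m0 lejs} ltl.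
  rewrite (nth_map i0) // mcoeff_Xmul_eq0 //; apply/eqP/negPn/m0.
  by rewrite -(nth_take i0 (ltn_ord l)) mem_nth // size_take_min (minn_idPl lejs).
rewrite [p]mpolyE big_seq; elim/big_ind: _ => [|p1 p2|m].
- exact: in_span0.
- exact: in_spanD.
rewrite mcoeff_msupp => /suppp/hasP[i /[dup] ij /mem_take is_ mi].
rewrite -[in X in 'X_[X]](submK (_ : (U_(i) <= m)%MM)); last first.
  by apply/mnm_lepP => i'; rewrite mnm1E; case: eqVneq => // <-; rewrite lt0n.
have lti : (index i s < j)%N by exact: index_ltn.
have -> : p@_m *: 'X_[m - U_(i) + U_(i)] =
    nth 0 [seq 'X_i | i <- s] (index i s) *: (p@_m *: 'X_[m - U_(i)] : S^o).
  rewrite (nth_map i) ?(leq_trans lti) // nth_index // [RHS]mulrC.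
  by rewrite mpolyXD scalerAl.
exact: in_span_mem.
Qed.

(** Multiplication by a variable changes only the exponent of that variable. As [s] has no
    repetitions, an earlier variable dividing the new monomial already divided the old one. *)
Lemma regular_on_X (s : seq 'I_n) :
  uniq s -> regular_on (fun l => nth 0 [seq 'X_i | i <- s] l : S) S^o (size s).
Proof.
move=> us j p ltjs /(in_span_X _ (ltnW ltjs)) Xp.
apply/(in_span_X _ (ltnW ltjs)) => m pm.
have i0 : 'I_n by case: s {us Xp} ltjs.
have /Xp/hasP[i ij] : (nth 0 [seq 'X_i | i <- s] j *: p)@_(m + U_(nth i0 s j)) != 0.
  by rewrite (nth_map i0) // -[_ *: _]/(_ * p) mulrC addmC mcoeffMX.
rewrite mnmDE mnm1E; case: (nth i0 s j =P i) => [iE|_]; last first.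
  by rewrite addn0 => mi; apply/hasP; exists i.
move=> _; move: ij; rewrite -iE => /(nthP i0)[l]; rewrite size_take_min.
move=> /leq_trans/(_ (geq_minl _ _)) ltlj.
rewrite nth_take // => /eqP; rewrite nth_uniq ?ltn_eqF //.
exact: ltn_trans ltlj ltjs.
Qed.

End RegularVariables.

(** * Rank, bases and hyperplanes in geometric lattices *)

Section GeometricLattice.
Local Open Scope order_scope.
Variables (d : Order.disp_t) (L : finTBLatticeType d) (rk : L -> int).
Hypothesis rkP : rank_function rk.

(** Strictness comes from one cover: among the elements that are at least [x] and strictly below
    [y], one with the most elements below it is covered by [y]. *)
Lemma rank_lt x y : x < y -> (rk x < rk y)%R.
Proof.
have [rkh _ rkc] := rkP => ltxy.
case: (@arg_maxnP L x (fun z => x <= z < y) (fun z => #|[pred w | w < z]|)).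
  by rewrite lexx.
move=> z /andP[lexz ltzy] zmax; have -> : rk y = (rk z + 1)%R.
  apply: rkc; rewrite /covers ltzy; apply/forallP => w.
  apply/negP => /andP[ltzw ltwy].
  have := zmax w; rewrite (le_trans lexz (ltW ltzw)) ltwy => /(_ isT).
  rewrite /= leqNgt => /negP; apply; apply: proper_card; apply/properP; split.
    by apply/subsetP => v; rewrite !inE => /lt_trans; apply.
  by exists z; rewrite !inE ?ltxx.
have := rkh _ _ lexz; lia.
Qed.

Lemma rank_ge0 x : (0 <= rk x)%R.
Proof. by have [rkh <- _] := rkP; apply: rkh. Qed.

Lemma rank_top_le x : (rk \top <= rk x)%R -> x = \top.
Proof.
move=> h; apply/eqP; rewrite -[_ == _]negbK; apply/negP => x1.
by have := rank_lt (_ : x < \top); rewrite lt_neqAle x1 lex1 => /(_ isT); lia.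
Qed.

Lemma rank_bot_ge x : (rk x <= 0)%R -> x = \bot.
Proof.
move=> h; apply/eqP; rewrite -[_ == _]negbK; apply/negP => x0.
have := rank_lt (_ : \bot < x); rewrite lt_neqAle eq_sym x0 le0x => /(_ isT).
have [_ -> _] := rkP; lia.
Qed.

Hypothesis rk_semimod :
  forall x y, (rk (x `&` y) + rk (x `|` y) <= rk x + rk y)%R.
Hypothesis L_atomic : atomic L.

Lemma rank_atom a : atom a -> rk a = 1%R.
Proof. by have [_ rk0 rkc] := rkP => /rkc ->; rewrite rk0. Qed.

Lemma rank_join_atom_le a x : atom a -> (rk (a `|` x) <= rk x + 1)%R.
Proof.
move=> /rank_atom rka.
by have := rk_semimod a x; have := rank_ge0 (a `&` x); rewrite rka; lia.
Qed.

Lemma rank_join_atom a x : atom a -> ~~ (a <= x) -> rk (a `|` x) = (rk x + 1)%R.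
Proof.
move=> a_atom ax; apply/eqP; rewrite eq_le rank_join_atom_le //= lezD1.
by apply: rank_lt; rewrite lt_neqAle leUr andbT eq_sym eq_joinr.
Qed.

(** Atoms are added greedily: below rank [r] some atom is not under the current join, and joining it
    raises the rank by exactly one. *)
Lemma exists_basis (r : nat) : rk \top = r -> exists b : 'I_r -> L,
  (forall i, atom (b i)) /\ \join_i b i = \top.
Proof.
move=> rk1; suff [s [/= ss sa rks]] : exists s : seq L,
    [/\ size s = r, all (@atom _ L) s & rk (\join_(a <- s) a) = r].
  exists (fun i => nth \bot s i); split=> [i|].
    by apply: (allP sa); rewrite mem_nth ?ss.
  apply: rank_top_le; rewrite rk1 -rks; case: r / ss {rk1 rks}.
  by rewrite (big_nth \bot) big_mkord.
suff: forall k, (k <= r)%N -> exists s : seq L,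
    [/\ size s = k, all (@atom _ L) s & rk (\join_(a <- s) a) = k].
  exact.
elim=> [|k IH] ltkr.
  by exists [::]; split=> //; rewrite big_nil; have [_ -> _] := rkP.
have [s [ss sa rks]] := IH (ltnW ltkr); set x := \join_(a <- s) a in rks.
have [A Aat topE] := L_atomic \top.
have [a aA ax] : exists2 a, a \in A & ~~ (a <= x).
  apply/exists_inP; rewrite -negb_forall_in; apply/negP => /forall_inP Ax.
  have : \top <= x by rewrite topE; apply/joinsP.
  by rewrite le1x => /eqP x1; move: rks; rewrite x1 rk1; lia.
exists (a :: s); split; rewrite /= ?ss ?sa ?Aat //.
by rewrite big_cons rank_join_atom ?Aat // rks -PoszD addn1.
Qed.

(* The H i are the hyperplanes spanned by a basis b with b i left out. *)
Lemma exists_dual_basis (r : nat) : rk \top = r -> exists b H : 'I_r -> L,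
  [/\ forall i l, (b l <= H i) = (l != i),
      forall i, H i < \top,
      forall i x, x <= H i \/ H i `|` x = \top
    & \meet_i H i = \bot].
Proof.
move=> rk1; have [b [b_atom b_top]] := exists_basis rk1.
pose H i := \join_(l | l != i) b l.
have bH i l : l != i -> b l <= H i by move=> li; apply: joins_sup.
have Hb i : H i `|` b i = \top by rewrite joinC -b_top (bigD1 i).
(* A join of [r - 1] atoms has rank at most [r - 1]; one more atom reaches [\top], so the rank is no
   less. *)
have rkH i : rk (H i) = (rk \top - 1)%R.
  have le : (rk (H i) <= (\sum_(l | l != i) 1)%N)%R.
    rewrite /H; elim/big_rec2: _ => [|l c x _ IH]; first by have [_ -> _] := rkP.
    rewrite add1n -addn1 PoszD; apply: le_trans (rank_join_atom_le _ (b_atom l)) _.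
    by rewrite lerD2r.
  have := rank_join_atom_le (H i) (b_atom i); rewrite joinC Hb; move: le.
  rewrite sum1_card (cardC1 i) card_ord rk1; have := ltn_ord i; lia.
have Hlt1 i : H i < \top.
  rewrite lt_neqAle lex1 andbT; apply/eqP => Hi; have /eqP := rkH i.
  by rewrite Hi eq_sym -subr_eq0 addrAC subrr.
exists b, H; split=> // [i l|i x|].
- apply/idP/idP => [|/bH//]; apply: contraTneq => ->.
  apply/negP => /join_idPl; rewrite Hb => e.
  by have := Hlt1 i; rewrite -e ltxx.
- have [|xH] := boolP (x <= H i); [by left|right].
  apply: rank_top_le; rewrite -(subrK 1%R (rk \top)) -(rkH i) lezD1.
  by apply: rank_lt; rewrite lt_neqAle leUl andbT eq_sym eq_joinl.
(* Since [b i] lies below all the other hyperplanes, [H i] and their meet [x] join to [\top], and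
   semimodularity lowers the rank by at least one. *)
- have meetH (s : seq 'I_r) : uniq s ->
      (rk (\meet_(i <- s) H i) <= rk \top - (size s)%:Z)%R.
  elim: s => [|i s IH] /=; first by rewrite big_nil subr0.
  case/andP=> si /IH; rewrite big_cons; set x := \meet_(i <- s) H i => rkx.
  have bx : b i <= x.
    rewrite /x big_seq; elim/big_ind: _ => [|u v bu bv|l ls].
    - exact: lex1.
    - by rewrite lexI bu.
    - by apply: bH; apply: contraNneq si => ->.
  have Hx : H i `|` x = \top by apply/eqP; rewrite -le1x -(Hb i) leU2.
  rewrite -(lerD2r (rk \top)) -{1}Hx; apply: le_trans (rk_semimod _ _) _.
  by rewrite rkH; lia.
apply: rank_bot_ge; apply: le_trans (meetH _ (index_enum_uniq _)) _.
by rewrite -[index_enum _]enumT size_enum_ord rk1 subrr.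
Qed.

End GeometricLattice.

(** * Monomials outside the ideal that many variables multiply into it *)

Section LcmLattice.
Variables (k : fieldType) (n : nat) (I : submodClosed {mpoly k[n]}^o).
Local Notation S := {mpoly k[n]}.
Local Notation L := (lcm_lattice I).

Lemma monomial_in_le (m m' : 'X_{1..n}) :
  (m <= m')%MM -> ('X_[m] : S) \in I -> ('X_[m'] : S) \in I.
Proof.
by move=> le Im; rewrite -(submK le) mpolyXD; apply: (rpredZ 'X_[m' - m]).
Qed.

Lemma lcm_in_ideal (x : L) : x != \bot%O -> ('X_[lcm_val x] : S) \in I.
Proof.
move=> x0; have [[|g s] sI xE] := asboolW (lcm_valP x).
  by case/eqP: x0; apply: val_inj; rewrite /= xE big_nil.
have [Ig _] := sI g (mem_head _ _).
by rewrite xE big_cons (monomial_in_le _ Ig) // lem_mlcml.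
Qed.

Lemma min_gen_lcm g : min_gen I g -> exists x : L, lcm_val x = g.
Proof.
move=> Ig; have gP : `[< is_lcm I g >].
  apply/asboolP; exists [:: g] => [h|]; first by rewrite inE => /eqP ->.
  by rewrite big_cons big_nil mlcm0.
by exists (LcmLattice gP).
Qed.

Lemma lcm_lattice_unit (x : L) : (1 : S) \in I -> x = \bot%O.
Proof.
move=> I1; have [s sI xE] := asboolW (lcm_valP x); apply: val_inj.
rewrite /= xE big_seq; elim/big_ind: _ => [//|u v -> ->|g /sI[_ gmin]].
  by rewrite mlc0m.
by apply/esym/gmin; rewrite ?mpolyX0 //; apply/mnm_lepP => i; rewrite mnm0E.
Qed.

(** A lattice element reaches the top exponent at the variable [j i] exactly when it is not below
    [H i]. Lowering all these exponents by one excludes every generator, as only the bottom is below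
    all [H i] and [1] is not in [I]. Restoring the exponent at [j i] admits [b i], which is below
    every other hyperplane. *)
Lemma exists_socle (r : nat) : (1 : S) \notin I -> geometric L -> rank L = r ->
  exists (s : seq 'I_n) (w : 'X_{1..n}), [/\ uniq s, size s = r,
    ('X_[w] : S) \notin I & forall i, i \in s -> ('X_[U_(i) + w] : S) \in I].
Proof.
move=> I1 [[rk rkP rk_sm] L_at]; rewrite (rankE rkP) => rk1.
have [b [H [bH H1 Hx meetH]]] := exists_dual_basis rkP rk_sm L_at rk1.
pose top := lcm_val (\top%O : L).
have letop (x : L) i : (lcm_val x i <= top i)%N by have /mnm_lepP := lex1 x.
have exj i : exists v, (lcm_val (H i) v < top v)%N.
  apply/existsP; apply: contraLR (H1 i) => /existsPn no.
  rewrite lt_neqAle lex1 andbT negbK -le1x leEval.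
  apply/mnm_lepP => v; rewrite leqNgt.
  exact: no.
pose j i := xchoose (exj i).
have jP i : (lcm_val (H i) (j i) < top (j i))%N by apply: (xchooseP (exj i)).
have jtop i (x : L) : ~~ (x <= H i)%O -> lcm_val x (j i) = top (j i).
  case: (Hx i x) => [->//|e] _; have := jP i.
  have : top (j i) = maxn (lcm_val (H i) (j i)) (lcm_val x (j i)).
    by rewrite /top -e /= mnmE.
  lia.
have jinj : injective j.
  move=> i l eij; apply/eqP; apply: contraT => nil.
  have ib : lcm_val (b i) (j i) = top (j i) by apply: jtop; rewrite bH eqxx.
  have /mnm_lepP/(_ (j i)) : (b i <= H l)%O by rewrite bH.
  by rewrite ib eij leqNgt jP.
exists [seq j i | i <- enum 'I_r].
(* The truncated subtraction is harmless: at [j i] the top exponent exceeds that of [H i], so it is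
   positive. *)
exists [multinom (top v - (v \in codom j))%N | v < n]; split.
- by rewrite map_inj_uniq ?enum_uniq.
- by rewrite size_map size_enum_ord.
- apply/negP => /min_gen_below[g gI]; have [x xE] := min_gen_lcm gI.
  rewrite -xE => /mnm_lepP xw.
  have : ~~ [forall i, x <= H i]%O.
    apply: contra I1 => /forallP xH.
    have : (x <= \meet_i H i)%O by apply/meetsP.
    rewrite meetH lex0 => /eqP x0; rewrite -mpolyX0.
    by case: gI => + _; rewrite -xE x0.
  rewrite negb_forall => /existsP[i xi]; have := xw (j i).
  rewrite mnmE codom_f jtop //; have := jP i; lia.
- move=> _ /mapP[i _ ->]; apply: monomial_in_le (lcm_in_ideal (x := b i) _).
    apply/mnm_lepP => v; rewrite mnmDE mnm1E mnmE.
    have := letop (b i) v; case: codomP => [[l ->]|_]; last by lia.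
    have := jP l; case: (eqVneq i l) => [->|nil]; first by rewrite eqxx; lia.
    have /mnm_lepP/(_ (j l)) : (b i <= H l)%O by rewrite bH.
    by case: eqP => [/jinj|] _; lia.
  have : ~~ (b i <= H i)%O by rewrite bH eqxx.
  by apply: contraNneq => ->; apply: le0x.
Qed.

End LcmLattice.

(** * Graded submodules given by families, their syzygies, and the upper bound *)

Section GradedSubmodules.
Variables (k : fieldType) (n : nat) (I : submodClosed {mpoly k[n]}^o).
Local Notation S := {mpoly k[n]}.
Local Notation L := (lcm_lattice I).

Definition lcm_floor (m : 'X_{1..n}) : L :=
  (\join_(x : L | (lcm_val x <= m)%MM) x)%O.

Lemma le_lcm_floor (x : L) m : (x <= lcm_floor m)%O = (lcm_val x <= m)%MM.
Proof.
apply/idP/idP => [|xm]; last exact: joins_sup.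
rewrite leEval => /lepm_trans; apply; rewrite /lcm_floor.
elim/big_ind: _ => [|u v um vm|//]; first by apply/mnm_lepP => i; rewrite mnm0E.
by rewrite /= lem_mlcm um.
Qed.

Lemma lcm_floor_homo m m' : (m <= m')%MM -> (lcm_floor m <= lcm_floor m')%O.
Proof. by rewrite le_lcm_floor; apply: lepm_trans; rewrite -le_lcm_floor. Qed.

Definition coefv N m (v : 'rV[S]_N) : 'rV[k]_N := map_mx (mcoeff m) v.

Lemma coefvD N m (u v : 'rV[S]_N) : coefv m (u + v) = coefv m u + coefv m v.
Proof. exact: map_mxD. Qed.

Lemma coefv_mulmx N1 N2 m (v : 'rV[S]_N1) (B : 'M[k]_(N1, N2)) :
  coefv m (v *m map_mx (@mpolyC n k) B) = coefv m v *m B.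
Proof.
apply/rowP => i; rewrite !mxE raddf_sum; apply: eq_bigr => l _ /=.
by rewrite !mxE mulrC mcoeffCM mulrC.
Qed.

Lemma coefv_eq0 N (v : 'rV[S]_N) : (forall m, coefv m v = 0) -> v = 0.
Proof.
move=> v0; apply/rowP => i; apply/mpolyP => m.
by have /rowP/(_ i) := v0 m; rewrite !mxE mcoeff0.
Qed.

(* A functor from L to the subspaces of k^N, subspaces being row spaces. *)
Record family N := Family {
  fam :> L -> 'M[k]_N;
  fam_homo : forall x y, (x <= y)%O -> (fam x <= fam y)%MS }.

Definition gpred N (A : family N) : {pred 'rV[S]_N} :=
  fun v => `[< forall m, (coefv m v <= A (lcm_floor m))%MS >].

Lemma gpredP N (A : family N) v :
  reflect (forall m, (coefv m v <= A (lcm_floor m))%MS) (v \in gpred A).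
Proof. exact: asboolP. Qed.

(** Multiplication by a monomial can only raise the [lcm_floor] of a degree, and [A] is monotone. *)
Lemma gpred_submod_closed N (A : family N) : submod_closed (gpred A).
Proof.
split=> [|a u v /gpredP uA /gpredP vA]; apply/gpredP => m.
  by rewrite /coefv map_mx0 sub0mx.
rewrite coefvD addmx_sub //.
have -> : coefv m (a *: u) =
    \sum_(h : 'X_{1..n < (mdeg m).+1, (mdeg m).+1} | m == (h.1 + h.2)%MM)
      a@_h.1 *: coefv h.2 u.
  apply/rowP => i; rewrite mxE mxE mcoeffM summxE.
  by apply: eq_bigr => h _; rewrite !mxE.
apply: summx_sub => h /eqP mE; apply/scalemx_sub/(submx_trans (uA _))/fam_homo.
by apply: lcm_floor_homo; rewrite [X in (_ <= X)%MM]mE lem_addl.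
Qed.

HB.instance Definition _ N (A : family N) :=
  GRing.isSubmodClosed.Build S 'rV[S]_N (gpred A) (gpred_submod_closed A).

Record gmod N (A : family N) := GMod { gval : 'rV[S]_N; _ : gval \in gpred A }.

HB.instance Definition _ N (A : family N) := [isSub for @gval N A].
HB.instance Definition _ N (A : family N) := [Choice of gmod A by <:].
HB.instance Definition _ N (A : family N) :=
  [SubChoice_isSubLmodule of gmod A by <:].

Lemma gmodP N (A : family N) (v : gmod A) m :
  (coefv m (val v) <= A (lcm_floor m))%MS.
Proof. by have /gpredP := valP v. Qed.

(** The rows of [B] are bases of all the spaces [A c] put together, row [i] coming from [A (lab i)].
    Vectors supported on the label [c] are thus carried isomorphically onto [A c]. *)
Lemma exists_cover N (A : family N) :
  exists N' (lab : 'I_N' -> L) (B : 'M[k]_(N', N)),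
  [/\ forall i, (row i B <= A (lab i))%MS,
      forall i, A (lab i) != 0,
      forall c (u : 'rV_N), (u <= A c)%MS -> exists2 v : 'rV_N',
        (forall i, v 0 i != 0 -> lab i = c) & v *m B = u
    & forall c (v : 'rV_N'), (forall i, v 0 i != 0 -> lab i = c) ->
        v *m B = 0 -> v = 0].
Proof.
pose T : finType := {c : L & 'I_(\rank (A c))}.
pose lab (i : 'I_#|T|) : L := tag (enum_val i).
pose B : 'M[k]_(#|T|, N) :=
  \matrix_i row (tagged (enum_val i)) (row_base (A (lab i))).
pose idx c (l : 'I_(\rank (A c))) : 'I_#|T| :=
  enum_rank (Tagged (fun c => 'I_(\rank (A c))) l).
have mulB c (v : 'rV_#|T|) : (forall i, v 0 i != 0 -> lab i = c) ->
    v *m B = (\row_l v 0 (idx c l)) *m row_base (A c).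
  move=> vc; rewrite !mulmx_sum_row.
  pose F c' (l : 'I_(\rank (A c'))) := v 0 (idx c' l) *: row l (row_base (A c')).
  transitivity (\sum_(t : T) F (tag t) (tagged t)).
    rewrite (reindex (fun t : T => enum_rank t)) /=; last first.
      exact: onW_bij (@enum_rank_bij T).
    apply: eq_bigr => -[c' l] _.
    by rewrite rowK /lab enum_rankK.
  rewrite -(sig_big_dep xpredT (fun _ => xpredT) F) (bigD1 c) //=.
  rewrite [X in _ + X]big1 ?addr0 => [|c' nc].
    by apply: eq_bigr => l _; rewrite mxE.
  rewrite big1 // => l _; rewrite /F.
  have [->|/vc] := eqVneq (v 0 (idx c' l)) 0; first by rewrite scale0r.
  by rewrite /lab enum_rankK /= => e; rewrite e eqxx in nc.
exists #|T|, lab, B; split=> [i|i|c u|c v vc].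
- by rewrite rowK (submx_trans (row_sub _ _)) // eq_row_base.
- rewrite -mxrank_eq0 -lt0n; exact: leq_ltn_trans (ltn_ord (tagged (enum_val i))).
- rewrite -(eq_row_base (A c)) => /submxP[w ->].
  exists (\sum_l w 0 l *: delta_mx 0 (idx c l)) => [i|].
    apply: contraNeq => nic; rewrite summxE big1 // => l _; rewrite !mxE /=.
    case: eqP => [ie|_]; last by rewrite mulr0.
    by rewrite /lab ie enum_rankK eqxx in nic.
  rewrite mulmx_suml mulmx_sum_row; apply: eq_bigr => l _.
  by rewrite -scalemxAl -rowE rowK /lab enum_rankK.
- rewrite (mulB c v vc) => /eqP; rewrite mulmx_free_eq0 ?row_base_free //.
  move=> /eqP/rowP v0; apply/rowP => i; rewrite [RHS]mxE.
  apply: contraTeq isT => vi.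
  move: (vc i vi); rewrite /lab; move: vi; rewrite -(enum_valK i) enum_rankK.
  case: (enum_val i) => c' l /= vl ec; case: c / ec v0 {vc} => v0.
  by have := v0 l; rewrite !mxE => vl0; rewrite [v 0 _]vl0 eqxx in vl.
Qed.

Section Labelled.
Variables (N : nat) (lab : 'I_N -> L).

(** Projection to the coordinates with label at most [c]; its row space is the part at [c] of the
    free module with generators in degrees [lab i]. *)
Definition coord_mx (c : L) : 'M[k]_N := diag_mx (\row_i (lab i <= c)%O%:R).

Lemma coord_mxP c (u : 'rV[k]_N) :
  reflect (forall i, u 0 i != 0 -> (lab i <= c)%O) (u <= coord_mx c)%MS.
Proof.
apply: (iffP submxP) => [[w ->] i|uc].
  by rewrite mul_mx_diag !mxE; case: (_ <= _)%O; rewrite // mulr0 eqxx.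
exists u; apply/rowP => i; rewrite mul_mx_diag !mxE.
by case: (eqVneq (u 0 i) 0) => [->|/uc ->]; rewrite ?mul0r ?mulr1.
Qed.

Lemma coord_mx_homo x y : (x <= y)%O -> (coord_mx x <= coord_mx y)%MS.
Proof.
move=> xy; apply/rV_subP => u /coord_mxP ux; apply/coord_mxP => i /ux.
by move=> /le_trans; apply.
Qed.

Definition coord_family := Family coord_mx_homo.

(** Multiplying coordinate [i] by the monomial of [lab i] identifies [S^N] with this module, whose
    coordinate [i] contains only multiples of that monomial. *)
Lemma projective_coord : projective (gmod coord_family).
Proof.
pose f (v : 'rV[S]_N) : 'rV[S]_N := \row_i (v 0 i * 'X_[lcm_val (lab i)]).
have fP v : f v \in gpred coord_family.
  apply/gpredP => m; apply/coord_mxP => i; rewrite !mxE -mcoeff_msupp.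
  rewrite (perm_mem (msuppMX _ _)) => /mapP[m' _ ->].
  by rewrite le_lcm_floor lem_addr.
pose g v := GMod (fP v).
have glin : linear g.
  move=> a u v; apply: val_inj; rewrite [RHS]linearP /=.
  by apply/rowP => i; rewrite !mxE mulrDl mulrA.
pose gL : {linear 'rV[S]_N -> gmod coord_family} :=
  HB.pack g (GRing.isLinear.Build S 'rV[S]_N (gmod coord_family) *:%R g glin).
apply: (@projective_bij _ _ _ gL); first exact: projective_rV.
  move=> u v /(congr1 val)/rowP uv; apply/rowP => i; have := uv i.
  by rewrite !mxE => /mulIf; apply; rewrite -msupp_eq0 msuppX.
move=> w; pose q i := \sum_(m <- msupp (val w 0 i))
  (val w 0 i)@_m *: 'X_[m - lcm_val (lab i)] : S.
exists (\row_i q i); apply: val_inj; apply/rowP => i /=; rewrite !mxE mulr_suml.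
rewrite [RHS]mpolyE big_seq [RHS]big_seq; apply: eq_bigr => m.
rewrite mcoeff_msupp => wm; rewrite -scalerAl -mpolyXD submK // -le_lcm_floor.
by have /coord_mxP/(_ i) := gmodP w m; apply; rewrite mxE.
Qed.

End Labelled.

(** The kernel of the cover is again given by a family, because the constant matrix [B] acts on each
    degree separately. The last clause is the gain in rank at each syzygy. *)
Lemma gmod_resolution_step N (A : family N) :
  exists N' (A' : family N') (P : lmodType S) (i : {linear gmod A' -> P})
    (e : {linear P -> gmod A}),
  [/\ projective P, injective i, exact i e, surj e &
      forall (rk : L -> int) (d : int), {homo rk : x y / (x < y)%O >-> x < y} ->
        (forall c, rk c < d -> A c = 0) -> forall c, rk c <= d -> A' c = 0].
Proof.
have [N' [lab [B [BA A0 Asurj Ainj]]]] := exists_cover A.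
pose K c := (coord_mx lab c :&: kermx B)%MS.
have K_homo x y : (x <= y)%O -> (K x <= K y)%MS.
  by move=> xy; rewrite capmxS ?coord_mx_homo.
pose A' := Family K_homo; pose P := gmod (coord_family lab).
pose BS := map_mx (@mpolyC n k) B.
have eP (v : P) : val v *m BS \in gpred A.
  apply/gpredP => m; rewrite coefv_mulmx mulmx_sum_row.
  apply: summx_sub => i _; have [->|vi] := eqVneq (coefv m (val v) 0 i) 0.
    by rewrite scale0r sub0mx.
  apply/scalemx_sub/(submx_trans (BA i))/fam_homo.
  by have /coord_mxP := gmodP v m; apply.
pose e v := GMod (eP v).
have elin : linear e.
  move=> a u v; apply: val_inj; rewrite [RHS]linearP /=.
  by rewrite mulmxDl scalemxAl.
pose eL : {linear P -> gmod A} :=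
  HB.pack e (GRing.isLinear.Build S P (gmod A) *:%R e elin).
have iP (v : gmod A') : val v \in gpred (coord_family lab).
  by apply/gpredP => m; have := gmodP v m; rewrite sub_capmx => /andP[].
pose i v : P := GMod (iP v).
have ilin : linear i.
  by move=> a u v; apply: val_inj; rewrite [RHS]linearP.
pose iL : {linear gmod A' -> P} :=
  HB.pack i (GRing.isLinear.Build S (gmod A') P *:%R i ilin).
exists N', A', P, iL, eL; split.
- exact: projective_coord.
- by move=> u v /(congr1 val) uv; apply: val_inj.
- move=> v; split=> [/(congr1 val)/= vB|[u <-]].
    have vA' : val v \in gpred A'.
      apply/gpredP => m; rewrite sub_capmx; have -> /= := gmodP v m.
      apply/sub_kermxP; rewrite -coefv_mulmx vB.
      by rewrite /coefv map_mx0.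
    by exists (GMod vA'); apply: val_inj.
  apply: val_inj; apply: coefv_eq0 => m /=.
  rewrite coefv_mulmx; apply/sub_kermxP.
  by have := gmodP u m; rewrite sub_capmx => /andP[].
(* A preimage is built degree by degree. Outside the finite set [s] of degrees occurring in [w],
   injectivity on a single label forces [v m] to vanish, so summing over [s] loses nothing. *)
- move=> w; pose c m := lcm_floor m.
  have exv m := cid2 (Asurj (c m) _ (gmodP w m)).
  pose v m : 'rV[k]_N' := s2val (exv m).
  have vc m l : v m 0 l != 0 -> lab l = c m by apply: (s2valP (exv m)).
  have vB m : v m *m B = coefv m (val w) by apply: (s2valP' (exv m)).
  pose s := undup (flatten [seq msupp (val w 0 l) | l <- enum 'I_N]).
  have v0 m : m \notin s -> v m = 0.
    move=> ms; apply: (Ainj (c m)) (vc m) _; rewrite vB.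
    apply/rowP => l; rewrite !mxE; apply/eqP; rewrite mcoeff_eq0.
    apply: contra ms => ml; rewrite mem_undup; apply/flatten_mapP.
    by exists l; rewrite ?mem_enum.
  pose u : 'rV[S]_N' := \row_l \sum_(m <- s) v m 0 l *: 'X_[m].
  have uE m : coefv m u = v m.
    apply/rowP => l; rewrite !mxE raddf_sum /=.
    under eq_bigr do rewrite mcoeffZ mcoeffX.
    have [ms|ms] := boolP (m \in s).
      rewrite (bigD1_seq m) ?undup_uniq //= eqxx mulr1 big1 ?addr0 // => m'.
      by move=> /negPf ->; rewrite mulr0.
    rewrite v0 // mxE big_seq big1 // => m' ms'.
    by case: eqP => [em|_]; [rewrite -em ms' in ms|rewrite mulr0].
  have uP : u \in gpred (coord_family lab).
    apply/gpredP => m; rewrite uE; apply/coord_mxP => l /vc ->.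
    exact: lexx.
  exists (GMod uP); apply: val_inj => /=; apply/eqP; rewrite -subr_eq0; apply/eqP.
  apply: coefv_eq0 => m; rewrite coefvD coefv_mulmx uE vB.
  by rewrite /coefv map_mxN subrr.
(* A generator with label strictly below [c] would come from a rank less than [d], where [A] is
   zero. So a kernel vector at [c] is supported on the label [c], where the generators are
   independent. *)
- move=> rk d rk_lt Ad c cd; apply/eqP; rewrite -submx0; apply/rV_subP => u.
  rewrite sub_capmx => /andP[/coord_mxP uc /sub_kermxP uB].
  rewrite (Ainj c u) ?sub0mx // => l /uc; rewrite le_eqVlt => /predU1P[//|lc].
  by have := A0 l; rewrite Ad ?eqxx // (lt_le_trans (rk_lt _ _ lc)).
Qed.

(** Each syzygy step raises by one the rank up to which the family vanishes. At [d = 0] it vanishes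
    everywhere, so [e] is bijective and [M] is projective. *)
Lemma has_projres_gmod (rk : L -> int) (r : int) d :
  {homo rk : x y / (x < y)%O >-> x < y} -> (forall c, rk c <= r) ->
  forall N (A : family N) (P M : lmodType S) (i : {linear gmod A -> P})
    (e : {linear P -> M}),
  projective P -> injective i -> exact i e -> surj e ->
  (forall c, rk c <= r - d%:Z -> A c = 0) -> has_projres M d.
Proof.
move=> rk_lt rk_le; elim: d => [|d IH] N A P M i e projP iinj exie esurj A0.
  apply: has_projres_projective; apply: (projective_bij (f := e)) => // x y exy.
  apply/eqP; rewrite -subr_eq0; have /exie[v <-] : e (x - y) = 0.
    by rewrite linearB exy subrr.
  rewrite (_ : v = 0) ?linear0 //; apply: val_inj; apply: coefv_eq0 => m.
  by apply/eqP; rewrite -submx0; have := gmodP v m; rewrite A0 // subr0.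
apply: has_projres_step projP iinj exie esurj _.
have [N' [A' [P' [i' [e' [projP' i'inj exie' e'surj rkA']]]]]] :=
  gmod_resolution_step A.
apply: IH projP' i'inj exie' e'surj _ => c cr; apply: rkA' rk_lt _ c cr => c cr.
by apply: A0; move: cr; lia.
Qed.

Lemma has_projres_quotmod (rk : L -> int) (r : nat) :
  monomial_ideal I -> (1 : S) \notin I ->
  {homo rk : x y / (x < y)%O >-> x < y} -> rk \bot%O = 0 -> (forall c, rk c <= r) ->
  has_projres (quotmod I) r.
Proof.
move=> mI I1 rk_lt rk0 rk_le.
(* The bottom is the [lcm_floor] of the monomials outside [I]; everywhere else the ideal contains
   the whole line. *)
pose A (c : L) : 'M[k]_1 := if c == \bot%O then 0 else 1%:M.
have A_homo x y : (x <= y)%O -> (A x <= A y)%MS.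
  rewrite /A => xy; case: eqP => [_|/eqP x0]; first exact: sub0mx.
  by rewrite ifN ?submx_refl //; apply: contraNneq x0 => y0; rewrite y0 lex0 in xy.
pose AF := Family A_homo.
have memI (p : S^o) : p \in I <-> forall m, p@_m != 0 -> lcm_floor m != \bot%O.
  split=> [/(min_gen_gens mI)[s sI ->] m|pI].
    apply: contraNneq => m0; rewrite raddf_sum big_seq big1 // => t ts /=.
    rewrite mcoeffM big1 // => -[m1 m2] /= /eqP mE.
    rewrite mcoeffX; case: eqP => [em|_]; last by rewrite mulr0.
    have [x xE] := min_gen_lcm (sI t ts).
    have : (x <= lcm_floor m)%O.
      by rewrite le_lcm_floor xE em [X in (_ <= X)%MM]mE lem_addl.
    rewrite m0 lex0 => /eqP x0; case/negP: I1.
    by have [+ _] := sI t ts; rewrite -xE x0 mpolyX0.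
  rewrite [p]mpolyE big_seq; apply: rpred_sum => m.
  rewrite mcoeff_msupp => /pI/lcm_in_ideal Im.
  rewrite -mul_mpolyC; apply: (rpredZ (p@_m)%:MP).
  by apply: monomial_in_le Im; rewrite -le_lcm_floor.
pose i (v : gmod AF) : S^o := val v 0 0.
have ilin : linear i by move=> a u v; rewrite /i linearP !mxE.
pose iL : {linear gmod AF -> S^o} :=
  HB.pack i (GRing.isLinear.Build S (gmod AF) S^o *:%R i ilin).
pose e (p : S^o) : quotmod I := \pi_(quotmod I)%qT p.
have elin : linear e.
  by move=> a u v; rewrite /e pi_quotmodD -quot_scaleE.
pose eL : {linear S^o -> quotmod I} :=
  HB.pack e (GRing.isLinear.Build S S^o (quotmod I) *:%R e elin).
apply: (has_projres_gmod rk_lt rk_le (i := iL) (e := eL)).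
- exact: projective_regular.
- by move=> u v uv; apply: val_inj; apply/rowP => l; rewrite ord1.
- move=> p; apply: (iff_trans (B := p \in I)).
    by rewrite -pi_quotmod_eq0; split=> /eqP.
  rewrite memI; split=> [pI|[v <-] m].
    have vP : const_mx p \in gpred AF.
      apply/gpredP => m /=; rewrite /A; case: eqP => [m0|_]; last exact: submx1.
      rewrite submx0; apply/eqP/rowP => l; rewrite !mxE; apply/eqP.
      by apply: contraTT isT => /pI; rewrite m0 eqxx.
    by exists (GMod vP); rewrite /= /i mxE.
  apply: contraNneq => m0; have := gmodP v m; rewrite /= /A m0 eqxx submx0.
  by move=> /eqP/rowP/(_ 0); rewrite !mxE => ->.
- by move=> y; exists (repr y); rewrite /= /e reprK.
(* With [d = r] vanishing is required only in rank at most 0, that is, at the bottom. *)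
- move=> c; rewrite subrr /= /A => c0; case: eqP => // /eqP cn.
  have := rk_lt \bot%O c; rewrite lt_neqAle eq_sym cn le0x rk0 => /(_ isT).
  by rewrite ltNge c0.
Qed.

End GradedSubmodules.

(** * The two bounds combined *)

Theorem theorem5p1 (k : fieldType) (n : nat) (I : submodClosed {mpoly k[n]}^o) :
  monomial_ideal I ->
  geometric (lcm_lattice I) ->
  exists2 d : nat, has_projdim (quotmod I) d & rank (lcm_lattice I) = d%:Z.
Proof.
move=> mI geoL; have [[rk rkP _] _] := geoL.
(* For the unit ideal the lattice is a single point of rank 0, and the quotient is the zero module,
   of dimension 0 by convention. *)
have [I1|I1] := boolP ((1 : {mpoly k[n]}) \in I).
  have M0 (x : quotmod I) : x = 0.
    elim/quotW: x => p; apply/eqP.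
    by rewrite pi_quotmod_eq0 -[p]mulr1; apply: (rpredZ p).
  exists 0%N; first by split=> //; apply/has_projres_projective/projective_trivial.
  have [_ rk0 _] := rkP.
  by rewrite (rankE rkP) (lcm_lattice_unit \top%O I1) rk0.
have rk_ge0 := rank_ge0 rkP.
have rkE : rank (lcm_lattice I) = `|rk \top%O|%N.
  by rewrite (rankE rkP) gez0_abs ?rk_ge0.
exists `|rk \top%O|%N => //; split=> [|d].
  apply: (has_projres_quotmod mI I1 (rank_lt rkP)) => [|c].
    by have [] := rkP.
  by rewrite -rkE (rankE rkP); have [rkh _ _] := rkP; apply: rkh; apply: lex1.
have [s [w [us <- wI swI]]] := exists_socle I1 geoL rkE.
pose m : quotmod I := \pi_(quotmod I)%qT ('X_[w] : {mpoly k[n]}^o).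
apply: (projres_length (m := m) (regular_on_X us)).
  by move/eqP; rewrite pi_quotmod_eq0; apply/negP.
move=> l ltl; have i0 : 'I_n by case: s {us swI} ltl.
rewrite (nth_map i0) // -[_ *: m]/(quot_scale _ m) quot_scaleE.
apply/eqP; rewrite pi_quotmod_eq0.
rewrite -[_ *: _]/('X_[U_(nth i0 s l)] * 'X_[w]) -mpolyXD.
by apply: swI; apply: mem_nth.
Qed.
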